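(* Let $V_h\subset V=H^1_0(\Omega)$ and $Q_h\subset Q=H^{-1}(\Omega)$ be finite element subspaces satisfying the Babuška–Brezzi condition: there is a constant $\beta>0$, independent of the mesh, such that $$\sup_{0\ne v_h\in V_h}\frac{\langle v_h,\xi_h\rangle}{\|v_h\|_1}\ \ge\ \beta\,\|\xi_h\|_{-1}\qquad\forall\,\xi_h\in Q_h .$$ Then there exist positive constants $c,C$, independent of the mesh, such that for all $(v_h,\xi_h)\in V_h\times Q_h$ there exists $w_h\in V_h$ with $$\mathcal{B}(v_h,\xi_h;w_h,-\xi_h)\ \ge\ c\,\big(\|v_h\|_1+\|\xi_h\|_{-1}\big)^2\qquad\text{and}\qquad \|w_h\|_1\ \le\ C\,\big(\|v_h\|_1+\|\xi_h\|_{-1}\big).$$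
   Context: $\Omega\subset\mathbb{R}^2$ is a convex polygon with a conforming shape-regular triangulation $\mathcal{C}_h$; $V_h$ and $Q_h$ are finite-dimensional finite element spaces on $\mathcal{C}_h$. $\|v\|_1=(\|\nabla v\|_0^2+\|v\|_0^2)^{1/2}$ is the full $H^1(\Omega)$ norm, $(\cdot,\cdot)$ the $L^2(\Omega)$ inner product, $\langle\cdot,\cdot\rangle:V\times Q\to\mathbb{R}$ the duality pairing, and $\|\xi\|_{-1}=\sup_{0\ne v\in V}\langle v,\xi\rangle/\|v\|_1$. The bilinear form is $$\mathcal{B}(w,\xi;v,\mu)=(\nabla w,\nabla v)-\langle v,\xi\rangle-\langle w,\mu\rangle .$$ The constants $c,C$ may depend only on $\Omega$ and on $\beta$. *)

(* Defs.v *)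
From HB Require Import structures.
From mathcomp Require Import all_boot all_order all_algebra.
From mathcomp Require Import all_classical all_reals all_analysis.

Set Implicit Arguments.
Unset Strict Implicit.
Unset Printing Implicit Defensive.

Import Order.TTheory GRing.Theory Num.Theory.
Import numFieldNormedType.Exports.

Local Open Scope classical_set_scope.
Local Open Scope ring_scope.

Notation plane R := (measurableTypeR R * measurableTypeR R)%type.

(* The canonical norm on a product is the sup norm; it gives the usual topology,
   but diameters and discs below use the Euclidean distance. *)
Definition edist (R : realType) (x y : plane R) : R :=
  Num.sqrt ((x.1 - y.1) ^+ 2 + (x.2 - y.2) ^+ 2).

Definition convex_hull (R : realType) (s : seq (plane R)) : set (plane R) :=
  [set x | exists l : 'I_(size s) -> R,
    [/\ forall i, 0 <= l i,
        \sum_i l i = 1,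
        x.1 = \sum_i l i * (nth (0, 0) s i).1
      & x.2 = \sum_i l i * (nth (0, 0) s i).2] ].

Definition convex_polygon (R : realType) (Om : set (plane R)) : Prop :=
  Om !=set0 /\ exists s : seq (plane R), Om = interior (convex_hull s).

(* A triangle is given by its vertices; convex_hull t is the closed triangle. *)
Notation triangle R := (3.-tuple (plane R)).

(* The last condition says that two elements meet in the convex hull of their
   common vertices: the empty set, a vertex, an edge, or the whole triangle. *)
Definition conforming_triangulation (R : realType) (Om : set (plane R))
    (Ch : seq (triangle R)) : Prop :=
  [/\ forall t, t \in Ch -> interior (convex_hull t) !=set0,
      closure Om = [set x | exists2 t, t \in Ch & convex_hull t x]
    & forall t t', t \in Ch -> t' \in Ch ->
        convex_hull t `&` convex_hull t' =
        convex_hull [seq a <- t | a \in (t' : seq (plane R))] ].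

Definition shape_regular (R : realType) (kappa : R) (Ch : seq (triangle R)) :
    Prop :=
  forall t, t \in Ch -> exists (z : plane R) (rho : R),
    [/\ 0 < rho,
        [set x | edist z x <= rho] `<=` convex_hull t
      & forall x y, convex_hull t x -> convex_hull t y ->
          edist x y <= kappa * rho].

Definition mu2 (R : realType) : set (plane R) -> \bar R :=
  (@lebesgue_measure R \x @lebesgue_measure R)%E.

Definition unit_vec (R : realType) (i : 'I_2) : R * R :=
  if i == 0 then (1, 0) else (0, 1).

Definition partial (R : realType) (i : 'I_2) (f : plane R -> R) : plane R -> R :=
  fun x => 'D_(unit_vec R i) (f : R * R -> R) x.

Fixpoint Ck (R : realType) (k : nat) (f : plane R -> R) : Prop :=
  continuous (f : R * R -> R) /\
  if k is k'.+1 then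
    forall i : 'I_2,
      (forall x, derivable (f : R * R -> R) x (unit_vec R i))
      /\ Ck k' (partial i f)
  else True.

Definition test_function (R : realType) (Om : set (plane R))
    (f : plane R -> R) : Prop :=
  let supp := closure [set x : R * R | f x != 0] in
  [/\ forall k, Ck k f, compact supp & supp `<=` Om].

Definition ipL2 (R : realType) (Om : set (plane R)) (f g : plane R -> R) : R :=
  \int[@mu2 R]_(x in Om) (f x * g x).

Definition normL2 (R : realType) (Om : set (plane R)) (f : plane R -> R) : R :=
  Num.sqrt (ipL2 Om f f).

Definition L2 (R : realType) (Om : set (plane R)) (f : plane R -> R) : Prop :=
  measurable_fun Om f /\
  (\int[@mu2 R]_(x in Om) ((f x ^+ 2)%:E) < +oo)%E.

Definition is_weak_partial (R : realType) (Om : set (plane R)) (i : 'I_2)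
    (v g : plane R -> R) : Prop :=
  L2 Om g /\
  forall phi, test_function Om phi -> ipL2 Om v (partial i phi) = - ipL2 Om g phi.

(* Weak partial derivatives are unique up to a null set; one is chosen. *)
Definition weak_partial (R : realType) (Om : set (plane R)) (i : 'I_2)
    (v : plane R -> R) : plane R -> R :=
  xget (cst 0) [set g | is_weak_partial Om i v g].

Definition H1 (R : realType) (Om : set (plane R)) (v : plane R -> R) : Prop :=
  L2 Om v /\ forall i, exists g, is_weak_partial Om i v g.

Definition ip_grad (R : realType) (Om : set (plane R)) (v w : plane R -> R) : R :=
  \sum_(i < 2) ipL2 Om (weak_partial Om i v) (weak_partial Om i w).

Definition norm1 (R : realType) (Om : set (plane R)) (v : plane R -> R) : R :=
  Num.sqrt (ip_grad Om v v + normL2 Om v ^+ 2).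

(* H^1_0 is the closure of the test functions in H^1. The condition on phi is
   |v - phi|_1 < e, the weak gradient of v - phi being the weak gradient of v
   minus the classical gradient of phi. Elements are functions on the plane, of
   which only the values almost everywhere on Om matter. *)
Definition H10 (R : realType) (Om : set (plane R)) : set (plane R -> R) :=
  [set v | H1 Om v /\
    forall e : R, 0 < e -> exists2 phi, test_function Om phi &
      Num.sqrt (\sum_(i < 2)
                  normL2 Om (fun x => weak_partial Om i v x - partial i phi x) ^+ 2
                + normL2 Om (fun x => v x - phi x) ^+ 2) < e].

(* H^{-1} is the dual of H^1_0, and the pairing <v, xi> is xi v. Only the values
   of xi on H^1_0 matter. *)
Definition Hm1 (R : realType) (Om : set (plane R)) :
    set ((plane R -> R) -> R) :=
  [set xi | (forall (a : R) u v, H10 Om u -> H10 Om v ->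
               xi (fun x => a * u x + v x) = a * xi u + xi v)
         /\ exists M : R, forall v, H10 Om v -> `|xi v| <= M * norm1 Om v].

(* sup over the nonzero v in V of <v, xi> / |v|_1. For xi in Hm1 and V contained
   in H10 the quotients are bounded, and the value is 0 if V is zero. *)
Definition sup_quotient (R : realType) (Om : set (plane R))
    (V : set (plane R -> R)) (xi : (plane R -> R) -> R) : R :=
  sup [set xi v / norm1 Om v | v in
         [set v | V v /\ ~ ae_eq (@mu2 R) Om v (cst 0)]].

Definition normm1 (R : realType) (Om : set (plane R))
    (xi : (plane R -> R) -> R) : R :=
  sup_quotient Om (H10 Om) xi.

Definition lin_subspace (R : realType) (T : Type) (S : set (T -> R)) : Prop :=
  S (cst 0) /\
  forall (a : R) u v, S u -> S v -> S (fun x => a * u x + v x).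

(* Finite-dimensional with respect to the equality eqv of the ambient space. *)
Definition finite_dim (R : realType) (T : Type) (eqv : (T -> R) -> (T -> R) -> Prop)
    (S : set (T -> R)) : Prop :=
  exists (n : nat) (e : 'I_n -> T -> R),
    (forall i, S (e i)) /\
    forall u, S u -> exists l : 'I_n -> R,
      eqv u (fun x => \sum_(i < n) l i * e i x).

Definition poly2 (R : realType) (p : {poly {poly R}}) : plane R -> R :=
  fun x => (p.[x.1%:P]).[x.2].

Definition FE_space_H10 (R : realType) (Om : set (plane R))
    (Ch : seq (triangle R)) (Vh : set (plane R -> R)) : Prop :=
  [/\ Vh `<=` H10 Om,
      lin_subspace Vh,
      finite_dim (ae_eq (@mu2 R) Om) Vh
    & forall v t, Vh v -> t \in Ch ->
        exists p, ae_eq (@mu2 R) (convex_hull t) v (poly2 p)].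

(* The restriction of a functional to an element K is its restriction, as a
   distribution, to the test functions supported in the interior of K. *)
Definition FE_space_Hm1 (R : realType) (Om : set (plane R))
    (Ch : seq (triangle R)) (Qh : set ((plane R -> R) -> R)) : Prop :=
  [/\ Qh `<=` Hm1 Om,
      lin_subspace Qh,
      finite_dim (fun xi eta => forall v, H10 Om v -> xi v = eta v) Qh
    & forall xi t, Qh xi -> t \in Ch ->
        exists p, forall phi, test_function (interior (convex_hull t)) phi ->
          xi phi = ipL2 (convex_hull t) (poly2 p) phi].

Definition Babuska_Brezzi (R : realType) (Om : set (plane R)) (beta : R)
    (Vh : set (plane R -> R)) (Qh : set ((plane R -> R) -> R)) : Prop :=
  forall xi, Qh xi -> beta * normm1 Om xi <= sup_quotient Om Vh xi.

Definition Bform (R : realType) (Om : set (plane R))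
    (w : plane R -> R) (xi : (plane R -> R) -> R)
    (v : plane R -> R) (mu : (plane R -> R) -> R) : R :=
  ip_grad Om w v - xi v - mu w.

(* Main.v *)
Require Import Defs.
From HB Require Import structures.
From mathcomp Require Import all_boot all_order all_algebra.
From mathcomp Require Import all_classical all_reals all_analysis.
From mathcomp Require Import measurable_realfun.
From mathcomp Require Import ring lra.

Set Implicit Arguments.
Unset Strict Implicit.
Unset Printing Implicit Defensive.

Import Order.TTheory GRing.Theory Num.Theory.
Import numFieldNormedType.Exports.

Local Open Scope classical_set_scope.
Local Open Scope ring_scope.

(** Test with [w = v - t q], where the inf-sup condition provides [q] in [Vh] with
    [xi q >= (beta/2) |xi|_{-1} |q|_1] and [t] is chosen so that
    [|t q|_1 = (beta/2) |xi|_{-1}]. The terms [xi v] cancel in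
    [B(v, xi; w, -xi) = |grad v|^2 - t (grad v, grad q) + t xi q]; absorbing the
    cross term by Young's inequality leaves
    [|grad v|^2 / 2 + (beta^2/8) |xi|_{-1}^2], and the Poincare inequality on
    [H10] concludes. The latter passes to the limit from test functions, where on
    each horizontal line it follows by integrating the derivative of
    [x * phi(x, y)^2] over an interval at whose ends [phi] vanishes. *)

(** * Measurability of open sets and continuous functions in the plane *)

Lemma open_measurable_plane (R : realType) (U : set (R * R)) :
  open U -> measurable (U : set (plane R)).
Proof.
move=> oU.
(* The sigma-algebra of [plane R] is the product one, so the open set is exhibited as a countable
   union of measurable rectangles. Balls of the sup norm are squares; [F q] is the square with
   rational centre and radius [1/(n+1)] if it lies in [U], and empty otherwise. *)
pose F (q : rat * rat * nat) : set (plane R) :=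
  if pselect (ball ((ratr q.1.1, ratr q.1.2) : R * R) q.2.+1%:R^-1 `<=` U)
  then (ball (ratr q.1.1 : R) q.2.+1%:R^-1) `*` (ball (ratr q.1.2 : R) q.2.+1%:R^-1)
  else set0.
have -> : U = \bigcup_q F q.
  apply/seteqP; split => [[x y] Uxy | [x y] [q _]]; last first.
    by rewrite /F; case: pselect => s /=; last (by []); case=> ? ?; exact: (s (x, y)).
  have /nbhs_ballP[e /= e0 eU] := open_nbhs_nbhs (conj oU Uxy).
  (* A square of radius below [e / 2] that contains the point lies in the ball of radius [e] around
     it. *)
  have [n nlt] : exists n, n.+1%:R^-1 < e / 2.
    exists (Num.truncn (e / 2)^-1).
    by rewrite invf_plt ?posrE ?divr_gt0// truncnS_gt.
  have n0 : 0 < n.+1%:R^-1 :> R by rewrite invr_gt0.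
  have [p] : exists p : rat, ratr p \in `]x - n.+1%:R^-1, x + n.+1%:R^-1[%R.
    by apply: rat_in_itvoo; rewrite ltrD2l; apply: lt_trans n0; rewrite oppr_lt0.
  have [q] : exists q : rat, ratr q \in `]y - n.+1%:R^-1, y + n.+1%:R^-1[%R.
    by apply: rat_in_itvoo; rewrite ltrD2l; apply: lt_trans n0; rewrite oppr_lt0.
  rewrite !in_itv/= => /andP[q1 q2] /andP[p1 p2].
  have B (a b r : R) : b - r < a -> a < b + r -> ball a r b.
    by move=> ? ?; rewrite /ball /= ltr_norml; apply/andP; split; lra.
  have bx : ball (ratr p : R) n.+1%:R^-1 x.
    exact: B.
  have by_ : ball (ratr q : R) n.+1%:R^-1 y.
    exact: B.
  exists ((p, q), n) => //; rewrite /F /=; case: pselect => [s|nsub] /=; first by split.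
  have ne : n.+1%:R^-1 + n.+1%:R^-1 <= e by apply/ltW; rewrite (splitr e) ltrD.
  exfalso; apply: nsub => z [hu hv]; apply: eU; split => /=.
    by have := ball_triangle (ball_sym bx) hu; exact: le_ball.
  by have := ball_triangle (ball_sym by_) hv; exact: le_ball.
apply: countable_bigcupT_measurable; first exact: countableP.
move=> q; rewrite /F; case: pselect => s /=; last exact: measurable0.
by apply: measurableX; apply: open_measurable; apply: ball_open; rewrite invr_gt0.
Qed.

Lemma continuous_measurable_plane (R : realType) (D : set (plane R))
  (f : R * R -> R) : measurable D -> continuous f ->
  measurable_fun D (f : plane R -> R).
Proof.
move=> mD /continuousP cf.
apply: (measurability _ (RGenOpens.measurableE R)).
move=> _ [_ [a [b ->] <-]]; apply: measurableI => //.
by apply: open_measurable_plane; apply: cf; exact: interval_open.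
Qed.

(** * The inner product and norm of square-integrable functions *)

Section L2_theory.
Context (R : realType) (Om : set (plane R)).
Hypothesis mOm : measurable Om.
Implicit Types (f g h : plane R -> R) (a : R).

Lemma L2_integrable_sqr f : L2 Om f ->
  (@mu2 R).-integrable Om (EFin \o (fun x => f x ^+ 2)).
Proof.
move=> [mf foo]; apply/integrableP; split.
  by apply/measurable_EFinP; exact: measurable_funX.
under eq_integral do rewrite /= ger0_norm ?sqr_ge0//.
exact: foo.
Qed.

(** The product is dominated pointwise by [f ^ 2 + g ^ 2]. *)
Lemma L2_integrableM f g : L2 Om f -> L2 Om g ->
  (@mu2 R).-integrable Om (EFin \o (fun x => f x * g x)).
Proof.
move=> Lf Lg.
apply: (@le_integrable _ _ _ _ _ mOm _
  (EFin \o (fun x => f x ^+ 2 + g x ^+ 2))).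
- by apply/measurable_EFinP; apply: measurable_funM; [case: Lf|case: Lg].
- move=> x _ /=; rewrite lee_fin normrM.
  rewrite [leRHS]ger0_norm ?addr_ge0 ?sqr_ge0//.
  rewrite -(real_normK (num_real (f x))) -(real_normK (num_real (g x))).
  have : 0 <= (`|f x| - `|g x|) ^+ 2 by exact: sqr_ge0.
  have := normr_ge0 (f x); have := normr_ge0 (g x); nra.
- rewrite (_ : _ \o _ = (EFin \o (fun x => (f x ^+ 2)%R)) \+
    (EFin \o (fun x => (g x ^+ 2)%R)))%E//.
  by apply: integrableD => //; exact: L2_integrable_sqr.
Qed.

Lemma ipL2C f g : ipL2 Om f g = ipL2 Om g f.
Proof. by rewrite /ipL2; apply: eq_Rintegral => x _; rewrite mulrC. Qed.

Lemma ipL2_ge0 f : 0 <= ipL2 Om f f.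
Proof. by apply: Rintegral_ge0 => x _; rewrite -expr2 sqr_ge0. Qed.

Lemma normL2_sqr f : normL2 Om f ^+ 2 = ipL2 Om f f.
Proof. by rewrite sqr_sqrtr// ipL2_ge0. Qed.

Lemma ipL2_linear_l a f g h : L2 Om f -> L2 Om g -> L2 Om h ->
  ipL2 Om (fun x => a * f x + g x) h = a * ipL2 Om f h + ipL2 Om g h.
Proof.
move=> Lf Lg Lh; rewrite /ipL2 -RintegralZl//; last exact: L2_integrableM.
rewrite -RintegralD//; last 2 first.
- rewrite (_ : _ \o _ = fun x => (a%:E * (EFin \o (fun x => (f x * h x)%R)) x)%E).
    by apply: integrableZl => //; exact: L2_integrableM.
  by apply/funext => x /=; rewrite EFinM.
- exact: L2_integrableM.
- by apply: eq_Rintegral => x _; rewrite mulrDl mulrA.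
Qed.

Lemma L2_linear a f g : L2 Om f -> L2 Om g -> L2 Om (fun x => a * f x + g x).
Proof.
move=> Lf Lg; split.
  apply: measurable_funD; last by case: Lg.
  by apply: measurable_funM => //; case: Lf.
have /integrableP[_] : (@mu2 R).-integrable Om
  (EFin \o (fun x => a ^+ 2 * f x ^+ 2 + 2 * a * (f x * g x) + g x ^+ 2)).
  have -> : EFin \o (fun x => a ^+ 2 * f x ^+ 2 + 2 * a * (f x * g x) + g x ^+ 2)
    = (((fun x => (a ^+ 2)%:E * (EFin \o (fun x => (f x ^+ 2)%R)) x)
    \+ (fun x => (2 * a)%:E * (EFin \o (fun x => (f x * g x)%R)) x))
    \+ (EFin \o (fun x => (g x ^+ 2)%R)))%E.
    by apply/funext => x /=; rewrite !EFinD !EFinM.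
  apply: integrableD => //; last exact: L2_integrable_sqr.
  apply: integrableD => //; apply: integrableZl => //.
    exact: L2_integrable_sqr.
  exact: L2_integrableM.
apply: le_lt_trans; apply: ge0_le_integral => //.
- by move=> x _; rewrite lee_fin sqr_ge0.
- apply/measurable_EFinP; apply: measurable_funX; apply: measurable_funD.
    by apply: measurable_funM => //; case: Lf.
  by case: Lg.
- apply: measurableT_comp => //; apply/measurable_EFinP.
  have [mf _] := Lf; have [mg _] := Lg.
  apply: measurable_funD; last exact: measurable_funX.
  apply: measurable_funD; apply: measurable_funM => //.
    exact: measurable_funX.
  exact: measurable_funM.
- move=> x _ /=; rewrite lee_fin; apply: le_trans (ler_norm _).
  by rewrite le_eqVlt; apply/orP; left; apply/eqP; ring.
Qed.

Lemma L2_sub f g : L2 Om f -> L2 Om g -> L2 Om (fun x => f x - g x).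
Proof.
move=> Lf Lg; have := L2_linear (-1) Lg Lf.
by congr (L2 _ _); apply/funext => x; ring.
Qed.

Lemma ipL2_linear_r a f g h : L2 Om f -> L2 Om g -> L2 Om h ->
  ipL2 Om h (fun x => a * f x + g x) = a * ipL2 Om h f + ipL2 Om h g.
Proof. by move=> *; rewrite ipL2C ipL2_linear_l// !(ipL2C h). Qed.

Lemma ipL2_subl f g h : L2 Om f -> L2 Om g -> L2 Om h ->
  ipL2 Om (fun x => f x - g x) h = ipL2 Om f h - ipL2 Om g h.
Proof.
move=> Lf Lg Lh; rewrite addrC -mulN1r -ipL2_linear_l//.
by congr (ipL2 _ _); apply/funext => x; ring.
Qed.

(** The quadratic polynomial [Q] in [t], the squared norm of [f + t g], is nonnegative, which forces
    its discriminant to be nonpositive. *)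
Lemma cauchy_schwarz_ipL2 f g : L2 Om f -> L2 Om g ->
  `|ipL2 Om f g| <= normL2 Om f * normL2 Om g.
Proof.
move=> Lf Lg; rewrite -sqrtrM ?ipL2_ge0// -sqrtr_sqr ler_wsqrtr//.
set A := ipL2 Om f f; set B := ipL2 Om f g; set C := ipL2 Om g g.
have Q t : 0 <= A + 2 * t * B + t ^+ 2 * C.
  have := ipL2_ge0 (fun x => t * g x + f x).
  rewrite ipL2_linear_l ?ipL2_linear_r//; last exact: L2_linear.
  rewrite (ipL2C g f) -/A -/B -/C => h; apply: (le_trans h).
  by rewrite le_eqVlt; apply/orP; left; apply/eqP; ring.
have A0 : 0 <= A by exact: ipL2_ge0.
have := ipL2_ge0 g; rewrite -/C le_eqVlt => /predU1P[C0|C0].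
  (* With [C = 0] the polynomial is affine; if [B] were nonzero, this [t] would give it the value
     -1. *)
  rewrite -C0 mulr0; have [->|B0] := eqVneq B 0; first by rewrite expr0n.
  have := Q (- (A + 1) / (2 * B)); rewrite -C0 mulr0 addr0.
  suff -> : A + 2 * (- (A + 1) / (2 * B)) * B = -1 by lra.
  by field.
(* The minimiser of the quadratic. *)
have := Q (- B / C).
have -> : A + 2 * (- B / C) * B + (- B / C) ^+ 2 * C = (A * C - B ^+ 2) / C.
  by field; rewrite gt_eqF.
by rewrite pmulr_lge0 ?invr_gt0// subr_ge0.
Qed.

Lemma normL2_triangle f g : L2 Om f -> L2 Om g ->
  normL2 Om f <= normL2 Om (fun x => f x - g x) + normL2 Om g.
Proof.
move=> Lf Lg; have Lfg := L2_sub Lf Lg.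
rewrite -(@ler_pXn2r _ 2%N) ?nnegrE ?addr_ge0 ?sqrtr_ge0//.
rewrite sqrrD !normL2_sqr -mulr_natl.
have := cauchy_schwarz_ipL2 Lfg Lg.
have -> : ipL2 Om f f = ipL2 Om (fun x => f x - g x) (fun x => f x - g x)
    + 2 * ipL2 Om (fun x => f x - g x) g + ipL2 Om g g.
  rewrite !ipL2_subl// !(ipL2C _ (fun x => f x - g x)) !ipL2_subl//.
  by rewrite (ipL2C g f); ring.
by rewrite ler_norml; lra.
Qed.

End L2_theory.

(** * Test functions and their derivatives *)

Section test_functions.
Context (R : realType) (Om : set (plane R)).
Implicit Types phi : plane R -> R.

Lemma test_function_continuous phi : test_function Om phi ->
  continuous (phi : R * R -> R).
Proof. by case=> /(_ 0%N)[]. Qed.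

Lemma test_function_outside phi x : test_function Om phi -> ~ Om x -> phi x = 0.
Proof.
move=> [_ _ sub] nx; have [//|px] := eqVneq (phi x) 0.
by exfalso; apply: nx; apply: sub; apply: subset_closure.
Qed.

Lemma test_function_derivable i phi x : test_function Om phi ->
  derivable (phi : R * R -> R) x (unit_vec R i).
Proof. by case=> /(_ 1%N)[_ /(_ i)[]]. Qed.

(** Off the support [phi] vanishes on a neighbourhood, so its derivative vanishes there too, and the
    support does not grow. Derivatives of test functions can thus themselves be paired with weak
    derivatives. *)
Lemma test_function_partial i phi :
  test_function Om phi -> test_function Om (partial i phi).
Proof.
move=> [Cphi cpt sub].
have S : closure [set x : R * R | partial i phi x != 0]
    `<=` closure [set x : R * R | phi x != 0].
  rewrite [X in _ `<=` X](closure_id _).1; last exact: closed_closure.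
  apply: closureS => x /=; apply: contraPP => nx; apply/negP; rewrite negbK.
  have : nbhs x (~` closure [set x : R * R | phi x != 0]).
    by apply: open_nbhs_nbhs; split => //; apply/closed_openC/closed_closure.
  move=> nbx; apply/eqP; rewrite /partial.
  rewrite (@near_eq_derive _ _ _ _ (cst 0)) ?derive_cst//.
  apply: filterS nbx => y ny /=; apply/eqP; apply: contra_notT ny.
  exact: (@subset_closure _ [set z : R * R | phi z != 0] y).
split.
- by move=> k; have [_ /(_ i)[]] := Cphi k.+1.
- by apply: subclosed_compact cpt S; exact: closed_closure.
- exact: subset_trans S sub.
Qed.

Lemma test_function_bounded phi : test_function Om phi ->
  exists M : R, forall x, `|phi x| <= M.
Proof.
move=> tphi; have cphi := test_function_continuous tphi.
have [_ cpt _] := tphi.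
have /compact_bounded[M [_ /(_ (M + 1))]] :
    compact ((phi : R * R -> R) @` closure [set x : R * R | phi x != 0]).
  by apply: continuous_compact cpt; exact: continuous_subspaceT.
(* The maximum with 0 covers the points off the support. *)
rewrite ltrDl ltr01 => /(_ isT) HM; exists (Num.max 0 (M + 1)) => x.
have [->|px] := eqVneq (phi x) 0; first by rewrite normr0 le_max lexx.
rewrite le_max; apply/orP; right; apply: HM.
by exists x => //; exact: subset_closure.
Qed.

Hypotheses (mOm : measurable Om) (fOm : (@mu2 R Om < +oo)%E).

Lemma test_function_L2 phi : test_function Om phi -> L2 Om phi.
Proof.
move=> tphi; have mphi : measurable_fun Om phi.
  by apply: continuous_measurable_plane => //; exact: test_function_continuous.
split=> //; have [M HM] := test_function_bounded tphi.
apply: (@le_lt_trans _ _ (\int[@mu2 R]_(x in Om) (cst (M ^+ 2)%:E x))%E).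
  apply: ge0_le_integral => //.
  - by move=> x _; rewrite lee_fin sqr_ge0.
  - by apply/measurable_EFinP; exact: measurable_funX.
  - move=> x _ /=; rewrite lee_fin -real_normK ?num_real//.
    by rewrite lerXn2r ?nnegrE//; apply: le_trans (HM x).
rewrite integral_cst//; apply: lte_mul_pinfty => //.
by rewrite lee_fin sqr_ge0.
Qed.

End test_functions.

(** * The Poincare inequality for test functions *)

Lemma poincare_interval (R : realType) (d : R) (g g' : R -> R) : 0 < d ->
  (forall x : R, is_derive x 1 g (g' x)) -> continuous g' ->
  g d = 0 -> g (- d) = 0 ->
  (\int[@lebesgue_measure R]_(x in `[(- d)%R, d]) (g x ^+ 2)%:E <=
   (4 * d ^+ 2)%:E * \int[@lebesgue_measure R]_(x in `[(- d)%R, d]) (g' x ^+ 2)%:E)%E.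
Proof.
move=> d0 dg cg' gd gNd.
have cg : continuous g.
  move=> x; apply: differentiable_continuous; apply/derivable1_diffP.
  by have := dg x; case.
(* The derivative [h] of [F] has integral zero because [g] vanishes at both ends. Adding [2 h] under
   the integral therefore costs nothing, and the claim reduces to the pointwise bound
   [g ^ 2 <= 2 h + 4 d ^ 2 g' ^ 2]. *)
pose F x := x * g x ^+ 2.
pose h x := g x ^+ 2 + 2 * x * g x * g' x.
have dF (x : R) : is_derive x 1 F (h x).
  have dgx := dg x.
  apply: is_derive_eq; rewrite /GRing.scale /= /h; ring.
have cF x : {for x, continuous F}.
  apply: differentiable_continuous; apply/derivable1_diffP.
  by have := dF x; case.
have ch : continuous h.
  move=> x; apply: cvgD; first by exact: (cvgM (cg x) (cg x)).
  apply: cvgM; last exact: cg'.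
  by apply: cvgM; [apply: cvgM; [exact: cvg_cst|exact: cvg_id]|exact: cg].
have dNd : - d < d by lra.
have h0 : (\int[@lebesgue_measure R]_(x in `[(- d)%R, d]) (h x)%:E = 0)%E.
  rewrite (@continuous_FTC2 _ h F)//.
  - by rewrite /F gd gNd expr0n/= !mulr0 subee.
  - exact: continuous_subspaceT.
  - split.
    + by move=> x _; have := dF x; case.
    + by apply: cvg_at_right_filter; exact: cF.
    + by apply: cvg_at_left_filter; exact: cF.
  - by move=> x _; rewrite derive1E; have := dF x => -[].
have I (k : R -> R) : continuous k ->
    (@lebesgue_measure R).-integrable `[(- d)%R, d] (EFin \o k).
  move=> ck; apply: continuous_compact_integrable; first exact: segment_compact.
  exact: continuous_subspaceT.
have cg'2 : continuous (fun x => g' x ^+ 2).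
  by move=> x; exact: (cvgM (cg' x) (cg' x)).
have cg2 : continuous (fun x => g x ^+ 2).
  by move=> x; exact: (cvgM (cg x) (cg x)).
have -> : ((4 * d ^+ 2)%:E * \int[@lebesgue_measure R]_(x in `[(- d)%R, d]) (g' x ^+ 2)%:E
   = \int[@lebesgue_measure R]_(x in `[(- d)%R, d])
      (2%:E * (h x)%:E + (4 * d ^+ 2)%:E * (g' x ^+ 2)%:E))%E.
  rewrite integralD//; last 2 first.
  - exact: (integrableZl _ 2 (I _ ch)).
  - exact: (integrableZl _ (4 * d ^+ 2) (I _ cg'2)).
  rewrite (integralZl _ (I _ ch))// (integralZl _ (I _ cg'2))//.
  by rewrite h0 mule0 add0e.
apply: le_integral => //.
- exact: (I _ cg2).
- rewrite (_ : (fun x => _) = EFin \o (fun x => 2 * h x + 4 * d ^+ 2 * g' x ^+ 2)).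
    apply: I => x; apply: cvgD; apply: cvgM; try exact: cvg_cst; [exact: ch|exact: cg'2].
  by apply/funext => x /=; rewrite -!EFinM -EFinD.
- move=> x; rewrite inE/= in_itv/= => /andP[x1 x2].
  rewrite -!EFinM -EFinD lee_fin /h.
  (* Completing the square; the remainder is nonnegative since [|x| <= d]. *)
  rewrite -subr_ge0 [leRHS](_ : _ = (g x + 2 * x * g' x) ^+ 2
    + 4 * ((d ^+ 2 - x ^+ 2) * g' x ^+ 2)); last by ring.
  rewrite addr_ge0 ?sqr_ge0// mulr_ge0// mulr_ge0 ?sqr_ge0// subr_ge0.
  by rewrite -[leLHS]real_normK ?num_real// lerXn2r ?nnegrE ?(ltW d0)// ler_norml x1.
Qed.

(** The two difference quotients are the same function of the increment. This links derivatives in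
    the plane to calculus on a horizontal line. *)
Lemma partial0_is_derive (R : realType) (phi : plane R -> R) (x y : R) :
  derivable (phi : R * R -> R) (x, y) (unit_vec R 0) ->
  is_derive x 1 (fun t => phi (t, y)) (partial 0 phi (x, y)).
Proof.
have E : (fun h : R => h^-1 *:
      (((phi : R * R -> R) \o shift (x, y)) (h *: unit_vec R 0) - phi (x, y)))
    = (fun h : R => h^-1 *:
      (((fun t => phi (t, y)) \o shift x) (h *: (1 : R)) - phi (x, y))).
  apply/funext => h; congr (_ *: (phi _ - _)).
  by rewrite /unit_vec /=; congr (_, _); rewrite /= scaler0 add0r.
rewrite /derivable E => D; split; first exact: D.
by rewrite /partial /derive E.
Qed.

Lemma poincare_test_function (R : realType) (Om : set (plane R)) (d : R)
  (phi : plane R -> R) : measurable Om -> 0 < d ->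
  Om `<=` [set x | `|x.1| < d] -> test_function Om phi -> L2 Om (partial 0 phi) ->
  ipL2 Om phi phi <= 4 * d ^+ 2 * ipL2 Om (partial 0 phi) (partial 0 phi).
Proof.
move=> mOm d0 Omd tphi [_ Lp].
have tp := test_function_partial 0 tphi.
have mp : measurable_fun setT phi.
  by apply: continuous_measurable_plane => //; exact: test_function_continuous tphi.
have mp' : measurable_fun setT (partial 0 phi).
  by apply: continuous_measurable_plane => //; exact: test_function_continuous tp.
pose sq (psi : plane R -> R) z := (psi z ^+ 2)%:E.
have msq psi : measurable_fun setT psi -> measurable_fun setT (sq psi).
  by move=> mpsi; apply/measurable_EFinP; exact: measurable_funX.
have sq0 psi z : (0 <= sq psi z)%E by rewrite lee_fin sqr_ge0.
(* Test functions vanish off [Om], so the integral extends to the whole plane, where Tonelli slices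
   it into horizontal lines. *)
have tonelli psi : test_function Om psi -> measurable_fun setT psi ->
    (\int[@mu2 R]_(x in Om) sq psi x =
     \int[@lebesgue_measure R]_y fubini_G (@lebesgue_measure R) (sq psi) y)%E.
  move=> tpsi mpsi; rewrite integral_mkcond.
  rewrite (eq_integral (sq psi)); last first.
    move=> z _; rewrite patchE; case: ifPn => // /negP zOm.
    rewrite /sq (test_function_outside tpsi) ?expr0n// => Oz; apply: zOm.
    exact: mem_set.
  by rewrite /mu2 fubini_tonelli2//; exact: msq.
have strip psi y : test_function Om psi ->
    (fubini_G (@lebesgue_measure R) (sq psi) y =
    \int[@lebesgue_measure R]_(x in `[(- d)%R, d]) (psi (x, y) ^+ 2)%:E)%E.
  move=> tpsi; rewrite /fubini_G [RHS]integral_mkcond.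
  apply: eq_integral => x _; rewrite patchE; case: ifPn => // /negP xd.
  rewrite /sq (test_function_outside tpsi) ?expr0n// => /Omd /=.
  rewrite ltr_norml => /andP[x1 x2]; apply: xd.
  by rewrite inE/= in_itv/= !ltW.
(* [Om] lies in the open strip, so the ends of each slice are outside it. *)
have vanish y t : `|t| = d -> phi (t, y) = 0.
  move=> td; rewrite (test_function_outside tphi)// => /Omd /=.
  by rewrite td ltxx.
have le2 : (\int[@mu2 R]_(x in Om) sq phi x <=
   (4 * d ^+ 2)%:E * \int[@mu2 R]_(x in Om) sq (partial 0%R phi) x)%E.
  rewrite !tonelli// -ge0_integralZl//; last 3 first.
  - by apply: measurable_fun_fubini_tonelli_G => //; exact: msq.
  - by move=> y _; apply: integral_ge0 => x _; exact: sq0.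
  - by rewrite lee_fin mulr_ge0// sqr_ge0.
  apply: ge0_le_integral => //.
  - by move=> y _; apply: integral_ge0 => x _; exact: sq0.
  - by apply: measurable_fun_fubini_tonelli_G => //; exact: msq.
  - apply: measurable_funeM.
    by apply: measurable_fun_fubini_tonelli_G => //; exact: msq.
  move=> y _; rewrite !strip//; apply: poincare_interval => //.
  - move=> x; apply: partial0_is_derive; exact: test_function_derivable tphi.
  - move=> x; apply: (@continuous_comp R (R * R)%type R (fun t : R => (t, y : R))
        (partial 0 phi : R * R -> R)).
      by apply: (@cvg_pair _ _ _ _ (nbhs x) (nbhs (y : R)));
        [exact: cvg_id|exact: cvg_cst].
    exact: test_function_continuous tp _.
  - by rewrite vanish// ger0_norm// ltW.
  - by rewrite vanish// normrN ger0_norm// ltW.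
(* The real integral sends an infinite value to 0, so both sides must be known finite before the
   inequality can be read in the reals: the right one by hypothesis, the left one by [le2]. *)
have p0 : (0 <= \int[@mu2 R]_(x in Om) sq (partial 0%R phi) x)%E.
  by apply: integral_ge0 => z _; exact: sq0.
have pfin : (\int[@mu2 R]_(x in Om) sq (partial 0%R phi) x)%E \is a fin_num.
  by rewrite ge0_fin_numE.
have := le2; rewrite -(fineK pfin) -EFinM => le3.
rewrite -lee_fin; apply: le_trans le3.
rewrite /ipL2 /Rintegral fineK//.
rewrite ge0_fin_numE; last by apply: integral_ge0 => z _; exact: (sq0 phi).
by apply: le_lt_trans le2 _; rewrite -(fineK pfin) -EFinM ltry.
Qed.

(** * Boundedness and finite measure of convex polygons *)

Lemma convex_hull_bounded (R : realType) (s : seq (plane R)) :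
  exists2 d : R, 0 < d &
    convex_hull s `<=` [set x | `|x.1| < d /\ `|x.2| < d].
Proof.
(* Convex weights are at most 1, so the sum bounds both coordinates; the extra 1 makes the bounds
   strict and [d] positive. *)
exists (1 + \sum_(i < size s) (`|(nth (0, 0) s i).1| + `|(nth (0, 0) s i).2|)).
  by rewrite ltr_pwDl// sumr_ge0// => i _; rewrite addr_ge0.
move=> x [l [l0 l1 x1 x2]].
have l_le1 i : l i <= 1.
  by rewrite -l1 (bigD1 i)//= lerDl sumr_ge0.
split; [rewrite x1|rewrite x2]; rewrite (le_lt_trans (ler_norm_sum _ _ _))//;
  rewrite ltr_pwDl//; apply: ler_sum => i _; rewrite normrM (ger0_norm (l0 i)).
  by apply: (@le_trans _ _ `|(nth (0, 0) s i).1|); [rewrite ler_piMl|rewrite lerDl].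
by apply: (@le_trans _ _ `|(nth (0, 0) s i).2|); [rewrite ler_piMl|rewrite lerDr].
Qed.

Lemma convex_polygon_measurable (R : realType) (Om : set (plane R)) :
  convex_polygon Om -> measurable Om.
Proof.
by move=> [_ [s ->]]; apply: open_measurable_plane; exact: open_interior.
Qed.

Lemma convex_polygon_bounded (R : realType) (Om : set (plane R)) :
  convex_polygon Om ->
  exists2 d : R, 0 < d & Om `<=` [set x | `|x.1| < d /\ `|x.2| < d].
Proof.
move=> [_ [s ->]]; have [d d0 hd] := convex_hull_bounded s.
by exists d => // x /interior_subset /hd.
Qed.

Lemma bounded_mu2_lty (R : realType) (Om : set (plane R)) (d : R) :
  measurable Om -> Om `<=` [set x | `|x.1| < d /\ `|x.2| < d] ->
  (@mu2 R Om < +oo)%E.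
Proof.
move=> mOm Omd.
have mI : measurable (`[(- d)%R, d]%classic : set (measurableTypeR R)).
  exact: measurable_itv.
apply: (@le_lt_trans _ _ (@mu2 R (`[(- d)%R, d]%classic `*` `[(- d)%R, d]%classic))).
  apply: le_measure; rewrite ?inE//; first exact: measurableX.
  move=> x /Omd /= [/ltW + /ltW]; rewrite !in_itv/= !ler_norml.
  by move=> ? ?; split.
have [r Er] : exists r : R, @lebesgue_measure R `[(- d)%R, d]%classic = r%:E.
  rewrite lebesgue_measure_itv/=; case: ifP => _; first by exists (d - - d).
  by exists 0.
have -> : @mu2 R (`[(- d)%R, d]%classic `*` `[(- d)%R, d]%classic) = (r%:E * r%:E)%E.
  by rewrite /mu2 product_measure1E//; congr (_ * _)%E; exact: Er.
by rewrite -EFinM ltry.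
Qed.

(** * Weak gradients and the Poincare inequality in [H10] *)

Lemma weak_partialP (R : realType) (Om : set (plane R)) i (v : plane R -> R) :
  H1 Om v -> is_weak_partial Om i v (weak_partial Om i v).
Proof. by case=> _ /(_ i) [g hg]; exact: (xgetPex _ (ex_intro _ g hg)). Qed.

Section H10_theory.
Context (R : realType) (Om : set (plane R)).
Hypotheses (mOm : measurable Om) (fOm : (@mu2 R Om < +oo)%E).
Implicit Types (u v w : plane R -> R) (a : R).

Lemma H10_L2 v : H10 Om v -> L2 Om v.
Proof. by case=> -[]. Qed.

Lemma weak_partial_L2 i v : H10 Om v -> L2 Om (weak_partial Om i v).
Proof. by case=> /(weak_partialP i)[]. Qed.

Lemma weak_partial_test i v phi : H10 Om v -> test_function Om phi ->
  ipL2 Om v (partial i phi) = - ipL2 Om (weak_partial Om i v) phi.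
Proof. by move=> [/(weak_partialP i)[_ h] _]; exact: h. Qed.

Lemma H10_approx v (e : R) : H10 Om v -> 0 < e -> exists phi,
  [/\ test_function Om phi, normL2 Om (fun x => v x - phi x) < e
    & forall i, normL2 Om (fun x => weak_partial Om i v x - partial i phi x) < e].
Proof.
move=> [_ /[apply]] [phi tphi lte]; exists phi; split=> // [|i];
  apply: le_lt_trans lte; rewrite -[leLHS]ger0_norm ?sqrtr_ge0// -sqrtr_sqr;
  apply: ler_wsqrtr.
  by rewrite lerDr sumr_ge0// => i _; rewrite sqr_ge0.
rewrite (bigD1 i)//= -addrA lerDl addr_ge0 ?sqr_ge0// sumr_ge0// => j _.
by rewrite sqr_ge0.
Qed.

(* The gradient of u is a limit of partial i phi, and these are themselves test
   functions: pairing against them determines a weak derivative, so linearity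
   needs no almost everywhere uniqueness of the chosen representatives. *)
Lemma ipL2_weak_partial_linear i a u v w : H10 Om u -> H10 Om v -> H10 Om w ->
  H10 Om (fun x => a * v x + w x) ->
  ipL2 Om (weak_partial Om i u) (weak_partial Om i (fun x => a * v x + w x)) =
  a * ipL2 Om (weak_partial Om i u) (weak_partial Om i v)
    + ipL2 Om (weak_partial Om i u) (weak_partial Om i w).
Proof.
move=> Hu Hv Hw Hvw.
have Lu := weak_partial_L2 i Hu; have Lv := weak_partial_L2 i Hv.
have Lw := weak_partial_L2 i Hw; have Lvw := weak_partial_L2 i Hvw.
have Llin := L2_linear mOm a Lv Lw.
rewrite -ipL2_linear_r//; apply/eqP; rewrite -subr_eq0.
set f := weak_partial Om i (fun x => _) in Lvw *.
set g := (fun x => a * _ + _) in Llin *.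
rewrite (ipL2C Om _ f) (ipL2C Om _ g) -ipL2_subl// -normr_le0.
set z := (fun x => f x - g x).
have Lz : L2 Om z by exact: L2_sub.
(* [z] is orthogonal to all derivatives of test functions: [partial i phi] is a test function, so
   the defining identity applies to it for [v], [w] and their combination. *)
have z0 phi : test_function Om phi -> ipL2 Om z (partial i phi) = 0.
  move=> tphi; have tp := test_function_partial i tphi.
  have Lp := test_function_L2 mOm fOm tp.
  have Lpp := test_function_L2 mOm fOm (test_function_partial i tp).
  rewrite /z ipL2_subl// /g ipL2_linear_l// /f.
  have := weak_partial_test i Hvw tp.
  rewrite ipL2_linear_l//; [|exact: H10_L2..].
  have aux (F V W X Y : R) : a * X + Y = - F -> X = - V -> Y = - W ->
      F - (a * V + W) = 0 by move=> E EX EY; move: E; rewrite EX EY; lra.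
  move=> /aux; apply; exact: weak_partial_test.
apply/ler_addgt0Pl => e e0; rewrite addr0.
(* The added 1 keeps the tolerance [e / (normL2 Om z + 1)] meaningful when [z] has norm zero. *)
have Z1 : 0 < normL2 Om z + 1 by rewrite ltr_wpDl ?sqrtr_ge0.
have [phi [tphi _ /(_ i) lte]] := H10_approx Hu (divr_gt0 e0 Z1).
have Lp := test_function_L2 mOm fOm (test_function_partial i tphi).
(* By [z0], subtracting [partial i phi] from the gradient of [u] does not change the pairing with
   [z], and Cauchy-Schwarz makes the new pairing small. *)
rewrite ipL2C -[X in `|X|]subr0 -(z0 _ tphi) (ipL2C Om z) -ipL2_subl//.
have Lup : L2 Om (fun x => weak_partial Om i u x - partial i phi x).
  exact: L2_sub.
apply: le_trans (cauchy_schwarz_ipL2 mOm Lup Lz) _.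
apply: (@le_trans _ _ (e / (normL2 Om z + 1) * (normL2 Om z + 1))).
  by apply: ler_pM; rewrite ?sqrtr_ge0 ?(ltW lte)// lerDl.
by rewrite divfK// gt_eqF.
Qed.

Lemma ip_gradC u v : ip_grad Om u v = ip_grad Om v u.
Proof. by apply: eq_bigr => i _; rewrite ipL2C. Qed.

Lemma ip_grad_ge0 u : 0 <= ip_grad Om u u.
Proof. by apply: sumr_ge0 => i _; exact: ipL2_ge0. Qed.

(** Membership of the combination in [H10] is a hypothesis; in the final argument it comes from [Vh]
    being a linear subspace inside [H10]. *)
Lemma ip_grad_linear_r a u v w : H10 Om u -> H10 Om v -> H10 Om w ->
  H10 Om (fun x => a * v x + w x) ->
  ip_grad Om u (fun x => a * v x + w x) = a * ip_grad Om u v + ip_grad Om u w.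
Proof.
move=> Hu Hv Hw Hvw; rewrite /ip_grad mulr_sumr -big_split/=.
by apply: eq_bigr => i _; exact: ipL2_weak_partial_linear.
Qed.

Lemma ip_grad_sqr_linear a v w : H10 Om v -> H10 Om w ->
  H10 Om (fun x => a * v x + w x) ->
  ip_grad Om (fun x => a * v x + w x) (fun x => a * v x + w x) =
  a ^+ 2 * ip_grad Om v v + 2 * a * ip_grad Om v w + ip_grad Om w w.
Proof.
move=> Hv Hw Hvw; rewrite (ip_grad_linear_r Hvw Hv Hw Hvw).
rewrite (ip_gradC _ v) (ip_gradC _ w).
rewrite (ip_grad_linear_r Hv Hv Hw Hvw) (ip_grad_linear_r Hw Hv Hw Hvw) (ip_gradC w v).
by move: (ip_grad Om v v) (ip_grad Om v w) (ip_grad Om w w) => *; ring.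
Qed.

Lemma norm1_sqr v : norm1 Om v ^+ 2 = ip_grad Om v v + ipL2 Om v v.
Proof.
by rewrite /norm1 normL2_sqr sqr_sqrtr// addr_ge0 ?ip_grad_ge0 ?ipL2_ge0.
Qed.

Lemma norm1_sqr_linear a v w : H10 Om v -> H10 Om w ->
  H10 Om (fun x => a * v x + w x) ->
  norm1 Om (fun x => a * v x + w x) ^+ 2 =
  a ^+ 2 * norm1 Om v ^+ 2 + 2 * a * (ip_grad Om v w + ipL2 Om v w)
    + norm1 Om w ^+ 2.
Proof.
move=> Hv Hw Hvw; rewrite !norm1_sqr ip_grad_sqr_linear//.
have Lv := H10_L2 Hv; have Lw := H10_L2 Hw.
have Lvw := L2_linear mOm a Lv Lw.
rewrite (ipL2_linear_l _ _ Lv Lw Lvw)// !(ipL2_linear_r _ _ Lv Lw)// (ipL2C Om w v).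
move: (ip_grad Om v v) (ip_grad Om v w) (ip_grad Om w w).
by move: (ipL2 Om v v) (ipL2 Om v w) (ipL2 Om w w) => *; ring.
Qed.

Lemma poincare_H10 (d : R) v : 0 < d -> Om `<=` [set x | `|x.1| < d] ->
  H10 Om v -> ipL2 Om v v <= 4 * d ^+ 2 * ip_grad Om v v.
Proof.
move=> d0 Omd Hv; have Lv := H10_L2 Hv; have Lw := weak_partial_L2 0 Hv.
set K := 2 * d; have K0 : 0 < K by rewrite mulr_gt0.
have main : normL2 Om v <= K * normL2 Om (weak_partial Om 0 v).
  apply/ler_addgt0Pl => e e0.
  have K1 : 0 < K + 1 by rewrite addr_gt0.
  (* The error is [e / (K + 1)] in the function and [K] times as much from the derivative, in total
     [e]. *)
  have [phi [tphi l1 /(_ 0) l2]] := H10_approx Hv (divr_gt0 e0 K1).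
  have Lphi := test_function_L2 mOm fOm tphi.
  have Lp := test_function_L2 mOm fOm (test_function_partial 0 tphi).
  have T1 := normL2_triangle mOm Lv Lphi.
  have T2 := normL2_triangle mOm Lp Lw.
  have T3 : normL2 Om phi <= K * normL2 Om (partial 0 phi).
    have n0 f : 0 <= normL2 Om f by exact: sqrtr_ge0.
    have Kn0 : 0 <= K * normL2 Om (partial 0 phi) by rewrite mulr_ge0// ltW.
    rewrite -(@ler_pXn2r _ 2%N) ?nnegrE// exprMn !normL2_sqr.
    rewrite (_ : K ^+ 2 = 4 * d ^+ 2); last by rewrite /K; ring.
    exact: poincare_test_function.
  have S : normL2 Om (fun x => partial 0 phi x - weak_partial Om 0 v x) =
      normL2 Om (fun x => weak_partial Om 0 v x - partial 0 phi x).
    by rewrite /normL2; congr Num.sqrt; apply: eq_Rintegral => x _; ring.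
  rewrite S in T2.
  have T4 := ler_wpM2l (ltW K0) (le_trans T2 (lerD (ltW l2) (lexx _))).
  apply: le_trans (le_trans T1 (lerD (ltW l1) (le_trans T3 T4))) _.
  by rewrite mulrDr addrA lerD// -{1}(mul1r (e / _)) -mulrDl addrC mulrC divfK// gt_eqF.
rewrite -normL2_sqr.
apply: (@le_trans _ _ (K ^+ 2 * normL2 Om (weak_partial Om 0 v) ^+ 2)).
  have n0 f : 0 <= normL2 Om f by exact: sqrtr_ge0.
  by rewrite -exprMn lerXn2r// nnegrE// mulr_ge0// ltW.
rewrite normL2_sqr (_ : K ^+ 2 = 4 * d ^+ 2); last by rewrite /K; ring.
apply: ler_wpM2l; first by rewrite mulr_ge0// sqr_ge0.
rewrite /ip_grad big_ord_recl lerDl.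
by apply: sumr_ge0 => i _; exact: ipL2_ge0.
Qed.

End H10_theory.

(** * The dual norm as a supremum of quotients *)

Section dual_norm.
Context (R : realType) (Om : set (plane R)).
Implicit Types (V : set (plane R -> R)) (xi : (plane R -> R) -> R).

Lemma norm1_ge0 v : 0 <= norm1 Om v.
Proof. exact: sqrtr_ge0. Qed.

Lemma quotient_has_ubound V xi : V `<=` H10 Om -> Hm1 Om xi ->
  has_ubound [set xi v / norm1 Om v | v in
    [set v | V v /\ ~ ae_eq (@mu2 R) Om v (cst 0)]].
Proof.
(* The 0 in the maximum accounts for functions of norm zero, whose quotient is 0 by the convention
   on division. *)
move=> VH [_ [M HM]]; exists (Num.max 0 M) => _ [v [/VH Hv _] <-].
rewrite le_max; have := norm1_ge0 v; rewrite le_eqVlt => /predU1P[<-|n0].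
  by rewrite invr0 mulr0 lexx.
apply/orP; right; rewrite ler_pdivrMr//.
by apply: le_trans (HM v Hv); exact: ler_norm.
Qed.

Lemma quotient_le_sup V xi v : V `<=` H10 Om -> Hm1 Om xi -> V v ->
  ~ ae_eq (@mu2 R) Om v (cst 0) ->
  xi v / norm1 Om v <= sup_quotient Om V xi.
Proof.
move=> VH Hxi Vv v0; apply: ub_le_sup; first exact: quotient_has_ubound.
by exists v.
Qed.

(* If V is nonzero this follows by applying xi to some v and to - v. Otherwise
   the inf-sup condition for - xi, which is also in Q, bounds the functional
   from below. This avoids showing that H10 is closed under opposites. *)
Lemma normm1_ge0 (beta : R) V (Q : set ((plane R -> R) -> R)) xi : 0 < beta ->
  V `<=` H10 Om -> lin_subspace V -> Q `<=` Hm1 Om -> lin_subspace Q ->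
  Babuska_Brezzi Om beta V Q -> Q xi -> 0 <= normm1 Om xi.
Proof.
move=> beta0 VH [V0 Vlin] QH [Q0 Qlin] BB Qxi.
have Hxi := QH _ Qxi; rewrite leNgt; apply/negP => N0.
have neg v : H10 Om v -> ~ ae_eq (@mu2 R) Om v (cst 0) -> xi v < 0.
  move=> Hv v0; rewrite ltNge; apply/negP => xv0.
  have := quotient_le_sup (@subset_refl _ _) Hxi Hv v0.
  rewrite -/(normm1 Om xi) leNgt (lt_le_trans N0)//.
  by rewrite divr_ge0// norm1_ge0.
have [[v [Hv v0]]|Sv] := pselect (exists v, H10 Om v /\
    ~ ae_eq (@mu2 R) Om v (cst 0)); last first.
  move: N0; rewrite /normm1 /sup_quotient (_ : [set _ | _ in _] = set0).
    by rewrite sup0 ltxx.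
  by apply/seteqP; split => // t [v Hv _]; apply: Sv; exists v.
have [[q [Vq q0]]|Sq] := pselect (exists v, V v /\
    ~ ae_eq (@mu2 R) Om v (cst 0)).
  (* [xi] would be negative both at [q] and at its opposite, against linearity. *)
  have Vnq := Vlin (-1) _ _ Vq V0.
  have : xi (fun x => -1 * q x + cst 0 x) < 0.
    apply: neg; first exact: VH.
    move=> nq0; apply: q0; apply: filterS nq0 => x h Ox; have /= := h Ox; lra.
  rewrite Hxi.1; [|exact: VH..].
  (* Linearity at [1 * 0 + 0] yields [xi 0 = 0]. *)
  have := Hxi.1 1 _ _ (VH _ V0) (VH _ V0).
  rewrite (_ : (fun x => _) = cst 0); last by apply/funext => x /=; ring.
  by have := neg _ (VH _ Vq) q0; lra.
(* Here [V] has no nonzero element, so its supremum is that of the empty set, 0, and the inf-sup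
   condition gives [- xi] a nonpositive dual norm; yet [- xi] is positive at [v]. *)
have Qnxi := Qlin (-1) _ _ Qxi Q0.
have := BB _ Qnxi; rewrite /sup_quotient (_ : [set _ | _ in _] = set0); last first.
  by apply/seteqP; split => // t [w Hw _]; apply: Sq; exists w.
rewrite sup0 pmulr_rle0// => N1.
have := quotient_le_sup (@subset_refl _ _) (QH _ Qnxi) Hv v0.
rewrite -/(normm1 Om _) => /le_trans /(_ N1) /=; rewrite addr0 mulN1r mulNr.
have xv := neg _ Hv v0; rewrite oppr_le0 => h.
have [n0|n0] := eqVneq (norm1 Om v) 0.
  case: Hxi => _ [M /(_ v Hv)]; rewrite n0 mulr0 normr_le0 => /eqP xv0.
  by rewrite xv0 ltxx in xv.
have n1 : 0 < norm1 Om v by rewrite lt_neqAle eq_sym n0 norm1_ge0.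
by move: h; rewrite pmulr_lge0 ?invr_gt0// leNgt xv.
Qed.

End dual_norm.

(** * The stability estimate *)

Theorem theorem3p1 (R : realType) (Om : set (plane R)) (hOm : convex_polygon Om)
    (beta : R) (hbeta : 0 < beta) :
  exists c C : R, [/\ 0 < c, 0 < C &
    forall (kappa : R) (Ch : seq (triangle R))
      (Vh : set (plane R -> R)) (Qh : set ((plane R -> R) -> R)),
      conforming_triangulation Om Ch ->
      shape_regular kappa Ch ->
      FE_space_H10 Om Ch Vh ->
      FE_space_Hm1 Om Ch Qh ->
      Babuska_Brezzi Om beta Vh Qh ->
      forall (v : plane R -> R) (xi : (plane R -> R) -> R),
        Vh v -> Qh xi ->
        exists w : plane R -> R,
          [/\ Vh w,
              c * (norm1 Om v + normm1 Om xi) ^+ 2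
                <= Bform Om v xi w (fun u => - xi u)
            & norm1 Om w <= C * (norm1 Om v + normm1 Om xi)] ].
Proof.
have mOm := convex_polygon_measurable hOm.
have [d d0 Omd2] := convex_polygon_bounded hOm.
have fOm := bounded_mu2_lty mOm Omd2.
have Omd : Om `<=` [set x | `|x.1| < d] by move=> x /Omd2[].
(* Here [A], [B], [G] are the gradient products of [(q, q)], [(q, v)], [(v, v)], and [X], [Y] are
   [xi q], [xi v]. The first hypothesis, nonnegativity of the squared gradient norm of [v - t q], is
   Young's inequality for the cross term. *)
have arith (A B G X Y b N t : R) :
    0 <= t ^+ 2 * A + 2 * - t * B + G -> b ^+ 2 / 4 * N ^+ 2 <= t * X ->
    t ^+ 2 * A <= b ^+ 2 / 4 * N ^+ 2 ->
    G / 2 + b ^+ 2 / 8 * N ^+ 2 <= - t * B + G - (- t * X + Y) - - Y.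
  by move=> *; lra.
have arith2 (b a N : R) : 0 <= b -> 0 <= a -> 0 <= N ->
    b ^+ 2 / 2 * N ^+ 2 + 2 * a ^+ 2 <= ((2 + b) * (a + N)) ^+ 2.
  move=> b0 a0 N0; rewrite -subr_ge0 [leRHS](_ : _ = (2 + 4 * b + b ^+ 2) * a ^+ 2
    + (4 + 4 * b + b ^+ 2 / 2) * N ^+ 2 + 2 * (2 + b) ^+ 2 * (a * N)); last by field.
  by rewrite !(addr_ge0, mulr_ge0, sqr_ge0, divr_ge0).
(* By Poincare, [P] bounds the squared full norm by the squared gradient norm; it depends on [Om]
   only. *)
pose P := 1 + 4 * d ^+ 2.
have P1 : 1 <= P by rewrite lerDl mulr_ge0// sqr_ge0.
have P0 : 0 < P by exact: lt_le_trans P1.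
(* Half of the coefficients [P^-1 / 2] and [beta ^ 2 / 8]: the other factor 2 is lost in
   [(a + N) ^ 2 <= 2 a ^ 2 + 2 N ^ 2]. *)
pose c := Num.min (P^-1 / 4) (beta ^+ 2 / 16).
exists c, (2 + beta); split.
- by rewrite lt_min !divr_gt0 ?invr_gt0 ?exprn_gt0.
- by rewrite addr_gt0.
move=> kappa Ch Vh Qh _ _ [VH Vlin _ _] [QH Qlin _ _] BB v xi Vv Qxi.
have Hxi := QH _ Qxi; have Hv := VH _ Vv.
have N0 := normm1_ge0 hbeta VH Vlin QH Qlin BB Qxi.
have coercive : P^-1 * norm1 Om v ^+ 2 <= ip_grad Om v v.
  rewrite mulrC ler_pdivrMr// norm1_sqr /P mulrDr mulr1 lerD2l mulrC.
  exact: (poincare_H10 mOm fOm d0 Omd Hv).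
have c1 : c <= P^-1 / 4 by rewrite ge_min lexx.
have c2 : c <= beta ^+ 2 / 16 by rewrite ge_min lexx orbT.
have c0 : 0 <= c by rewrite le_min !divr_ge0 ?invr_ge0 ?sqr_ge0 ?ltW.
have split_sq (a N g : R) : P^-1 * a ^+ 2 <= g ->
    c * (a + N) ^+ 2 <= g / 2 + beta ^+ 2 / 8 * N ^+ 2.
  move=> ag.
  have h1 : (a + N) ^+ 2 <= 2 * a ^+ 2 + 2 * N ^+ 2.
    by have := sqr_ge0 (a - N); rewrite !expr2; lra.
  have h2 := ler_wpM2l c0 h1.
  have h3 := ler_wpM2r (sqr_ge0 a) c1; have h4 := ler_wpM2r (sqr_ge0 N) c2.
  by lra.
(* If [xi] has dual norm zero, then [w = v] works. Otherwise [beta / 2 * N] is strictly below the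
   supremum, which makes room to choose [q]. *)
have [Nz|Nn] := eqVneq (normm1 Om xi) 0.
  exists v; split=> //; rewrite ?Nz.
    have := split_sq _ 0 _ coercive; rewrite expr0n/= !mulr0 addr0 /Bform => h.
    apply: le_trans h _; have := ip_grad_ge0 Om v; lra.
  by rewrite addr0 ler_peMl ?norm1_ge0//; lra.
have {N0 Nn} N0 : 0 < normm1 Om xi by rewrite lt_neqAle eq_sym Nn.
set N := normm1 Om xi in N0 split_sq *.
have [q [Vq r]] : exists q, Vh q /\ beta / 2 * N < xi q / norm1 Om q.
  have lt_sup : beta / 2 * N < sup_quotient Om Vh xi.
    apply: lt_le_trans (BB _ Qxi); rewrite -/N ltr_pM2r//; lra.
  have ne : [set xi v / norm1 Om v | v in
      [set v | Vh v /\ ~ ae_eq (@mu2 R) Om v (cst 0)]] !=set0.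
    (* The empty set would have supremum 0, not above the nonnegative [beta / 2 * N]. *)
    apply/set0P/eqP => S0; move: lt_sup; rewrite /sup_quotient S0 sup0.
    by rewrite ltNge mulr_ge0 ?divr_ge0 ?ltW.
  have [_ [q [Vq _] <-] h] := sup_gt ne lt_sup.
  by exists q.
have Hq := VH _ Vq.
have r0 : 0 < xi q / norm1 Om q by apply: lt_trans r; rewrite mulr_gt0 ?divr_gt0.
have nq : 0 < norm1 Om q.
  rewrite lt_neqAle norm1_ge0 andbT eq_sym; apply/eqP => n0.
  by move: r0; rewrite n0 invr0 mulr0 ltxx.
pose t := beta / 2 * N / norm1 Om q.
have t0 : 0 <= t by rewrite divr_ge0 ?mulr_ge0 ?divr_ge0 ?norm1_ge0 ?ltW.
have tq : t ^+ 2 * norm1 Om q ^+ 2 = beta ^+ 2 / 4 * N ^+ 2.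
  by rewrite /t; field; rewrite gt_eqF.
have txi : beta ^+ 2 / 4 * N ^+ 2 <= t * xi q.
  have -> : t * xi q = (beta / 2 * N) * (xi q / norm1 Om q).
    by rewrite /t; field; rewrite gt_eqF.
  rewrite (_ : _ * N ^+ 2 = (beta / 2 * N) * (beta / 2 * N)); last by field.
  by rewrite ler_wpM2l ?mulr_ge0 ?divr_ge0 ?ltW.
have Vw := Vlin.2 (- t) _ _ Vq Vv; have Hw := VH _ Vw.
(* The combination with the opposite sign serves the norm bound: nonnegativity of its squared norm
   controls the cross term, so that [|v - t q|^2 <= 2 |t q|^2 + 2 |v|^2]. *)
have Vw' := Vlin.2 t _ _ Vq Vv; have Hw' := VH _ Vw'.
exists (fun x => - t * q x + v x); split => //.
- have Gqq : ip_grad Om q q <= norm1 Om q ^+ 2.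
    by rewrite norm1_sqr lerDl ipL2_ge0.
  have G1 := ip_grad_ge0 Om (fun x => - t * q x + v x).
  rewrite (ip_grad_sqr_linear mOm fOm Hq Hv Hw) in G1.
  rewrite /Bform (ip_grad_linear_r mOm fOm Hv Hq Hv Hw) (ip_gradC Om v q).
  rewrite (Hxi.1 _ _ _ Hq Hv).
  apply: le_trans (split_sq _ N _ coercive) _.
  have := ler_wpM2l (sqr_ge0 t) Gqq; rewrite tq.
  move: G1 txi; rewrite sqrrN.
  move: (ip_grad Om q q) (ip_grad Om q v) (ip_grad Om v v) (xi q) (xi v).
  by move=> A B G X Y; exact: arith.
- have W0 := sqr_ge0 (norm1 Om (fun x => t * q x + v x)).
  rewrite (norm1_sqr_linear mOm fOm Hq Hv Hw') in W0.
  rewrite -(@ler_pXn2r _ 2%N) ?nnegrE ?norm1_ge0//; last first.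
    by rewrite mulr_ge0 ?addr_ge0 ?norm1_ge0 ?ltW.
  rewrite (norm1_sqr_linear mOm fOm Hq Hv Hw) sqrrN.
  have a0 := norm1_ge0 Om v.
  move: W0; rewrite tq.
  move: (ip_grad Om q v + ipL2 Om q v) (norm1 Om v) a0 => B a a0 W0.
  apply: (@le_trans _ _ (beta ^+ 2 / 2 * N ^+ 2 + 2 * a ^+ 2)); first lra.
  exact: arith2 (ltW hbeta) a0 (ltW N0).
Qed.
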